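(* Let $n>3$. Every $n$-dimensional complex filiform associative algebra is isomorphic to one of the following pairwise non-isomorphic algebras with basis $\{e_1,e_2,\dots,e_n\}$: \[\begin{array}{llll} \mu_{1,1}^n: & e_ie_j=e_{i+j}; & & \\ \mu_{1,2}^n: & e_ie_j=e_{i+j}, & e_ne_n=e_{n-1}; & \\ \mu_{1,3}^n: & e_ie_j=e_{i+j}, & e_1e_n=e_{n-1}; & \\ \mu_{1,4}^n: & e_ie_j=e_{i+j}, & e_1e_n=e_{n-1}, & e_ne_n=e_{n-1}, \end{array}\] where in each case the relation $e_ie_j=e_{i+j}$ holds for all $i,j\ge 1$ with $2\le i+j\le n-1$, and all products of basis elements that are not listed vanish.
   Context: Associative algebras are not assumed to be unital. For an algebra $\mathcal{A}$ put $\mathcal{A}^1=\mathcal{A}$ and $\mathcal{A}^{i+1}=\sum_{k=1}^{i}\mathcal{A}^k\mathcal{A}^{i+1-k}$ for $i\ge 1$ (linear spans of products). An $n$-dimensional algebra $\mathcal{A}$ is called filiform if $\dim(\mathcal{A}^i)=n-i$ for $2\le i\le n$. *)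

(* Defs.v *)
From HB Require Import structures.
From mathcomp Require Import all_boot all_order all_algebra.

Set Implicit Arguments.
Unset Strict Implicit.
Unset Printing Implicit Defensive.

Import GRing.Theory.
Local Open Scope ring_scope.

(* Finite-dimensional algebras, neither unital nor associative a priori
   (the algebras of MathComp, such as falgType, all have a unit).
   Associativity is the separate predicate alg_assoc. *)
Record algebra (F : fieldType) := Algebra {
  alg_sort :> vectType F;
  alg_mul : {bilinear alg_sort -> alg_sort -> alg_sort}
}.
Arguments alg_mul {F A} : rename.

Definition alg_dim (F : fieldType) (A : algebra F) : nat := \dim {: A}.

Definition alg_assoc (F : fieldType) (A : algebra F) : Prop :=
  associative (@alg_mul F A).

Definition alg_iso (F : fieldType) (A B : algebra F) : Prop :=
  exists2 f : {linear A -> B}, bijective f &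
    forall x y : A, f (alg_mul x y) = alg_mul (f x) (f y).

(* The linear span of the products u v, for u in U and v in V: by bilinearity
   the products of basis vectors suffice, see alg_prodP (as for falgebra's
   prodv, which is only available in unital algebras). *)
Definition alg_prod (F : fieldType) (A : algebra F) (U V : {vspace A}) :
    {vspace A} :=
  <<[seq alg_mul u v | u <- vbasis U, v <- vbasis V]>>%VS.

(* The sequence A^1, ..., A^(m+1). *)
Fixpoint alg_powers (F : fieldType) (A : algebra F) (m : nat) :
    seq {vspace A} :=
  if m is m'.+1 then
    let s := alg_powers A m' in
    let P k := nth 0%VS s k.-1 in
    rcons s (\sum_(1 <= k < m.+1) alg_prod (P k) (P (m.+1 - k)%N))%VS
  else [:: fullv].

(* The power A^i, for i >= 1 (A^0 is a junk value); its recursive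
   characterization is alg_pow1 and alg_powS below. *)
Definition alg_pow (F : fieldType) (A : algebra F) (i : nat) : {vspace A} :=
  nth 0%VS (alg_powers A i.-1) i.-1.

Definition filiform (F : fieldType) (A : algebra F) : Prop :=
  forall i, (2 <= i <= alg_dim A)%N -> \dim (alg_pow A i) = (alg_dim A - i)%N.

Section Powers.
Variables (F : fieldType) (A : algebra F).

Lemma alg_prodP (U V W : {vspace A}) :
  reflect (forall u v, u \in U -> v \in V -> alg_mul u v \in W)
          (alg_prod U V <= W)%VS.
Proof.
apply: (iffP idP) => [sW u v Uu Vv|UVW].
  apply: (subvP sW).
  rewrite (coord_vbasis Uu) (coord_vbasis Vv) linear_sumr rpred_sum //= => j _.
  rewrite linear_sumlz rpred_sum //= => i _.
  rewrite linearZl_LR linearZr_LR !memvZ // memv_span //.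
  by apply/allpairsP; exists ((vbasis U)`_i, (vbasis V)`_j);
    rewrite !mem_nth ?size_tuple.
apply/span_subvP=> _ /allpairsP[[u v] /= [Uu Vv ->]].
by apply: UVW; rewrite vbasis_mem.
Qed.

Lemma size_alg_powers m : size (alg_powers A m) = m.+1.
Proof. by elim: m => //= m IHm; rewrite size_rcons IHm. Qed.

Lemma nth_alg_powers m k : (k <= m)%N ->
  nth 0%VS (alg_powers A m) k = alg_pow A k.+1.
Proof.
elim: m => [|m IHm]; first by rewrite leqn0 => /eqP->.
rewrite leq_eqVlt => /predU1P[-> //|le_km].
by rewrite /= nth_rcons size_alg_powers le_km IHm.
Qed.

Lemma alg_pow1 : alg_pow A 1 = fullv.
Proof. by []. Qed.

Lemma alg_powS i : (1 <= i)%N ->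
  alg_pow A i.+1 =
    (\sum_(1 <= k < i.+1) alg_prod (alg_pow A k) (alg_pow A (i.+1 - k)))%VS.
Proof.
case: i => // i _.
rewrite {1}/alg_pow /= nth_rcons size_alg_powers ltnn eqxx.
apply: eq_big_nat => -[//|k] /andP[_ lt_ki].
by rewrite subSS subSn //= !nth_alg_powers // leq_subr.
Qed.

End Powers.

(* Algebras given by structure constants. The index m runs over 1, ..., n:
   e_ m is the m-th vector of the canonical basis of 'rV_n. *)
Section Models.
Variables (F : fieldType) (n : nat).

Definition e_ (m : nat) : 'rV[F]_n := \row_(j < n) (j.+1 == m)%:R.

Variable T : nat -> nat -> 'rV[F]_n.

Definition table_mul (x y : 'rV[F]_n) : 'rV[F]_n :=
  \sum_(i < n) \sum_(j < n) (x 0 i * y 0 j) *: T i.+1 j.+1.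

Lemma table_mul_is_bilinear : bilinear_for *:%R *:%R table_mul.
Proof.
split=> [y|x] a u v; rewrite /table_mul /= scaler_sumr -big_split /=;
  apply: eq_bigr => i _; rewrite scaler_sumr -big_split /=;
  apply: eq_bigr => j _; rewrite !mxE.
  by rewrite mulrDl scalerDl -mulrA scalerA.
by rewrite mulrDr scalerDl mulrCA scalerA.
Qed.

HB.instance Definition _ :=
  bilinear_isBilinear.Build F 'rV[F]_n 'rV[F]_n 'rV[F]_n *:%R *:%R table_mul
    table_mul_is_bilinear.

Definition table_algebra : algebra F := @Algebra F 'rV[F]_n table_mul.

Lemma table_mul_e i j : (1 <= i <= n)%N -> (1 <= j <= n)%N ->
  table_mul (e_ i) (e_ j) = T i j.
Proof.
case: i j => [//|i] [//|j] /andP[_ lt_in] /andP[_ lt_jn].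
rewrite /table_mul (bigD1 (Ordinal lt_in)) //= (bigD1 (Ordinal lt_jn)) //=.
rewrite !big1 ?addr0 => [|i' ne_i|j' ne_j].
- by rewrite !mxE /= !eqxx mulr1 scale1r.
- rewrite big1 // => j' _; rewrite !mxE eqSS.
  by rewrite (negPf (ne_i : (i' : nat) != i)) mul0r scale0r.
- rewrite !mxE [j'.+1 == _]eqSS.
  by rewrite (negPf (ne_j : (j' : nat) != j)) mulr0 scale0r.
Qed.

End Models.

Inductive mu_label := mu11 | mu12 | mu13 | mu14.

(* The product e_i e_j, for 1 <= i, j <= n. *)
Definition mu_table (F : fieldType) (n : nat) (c : mu_label) (i j : nat) :
    'rV[F]_n :=
  let base := if (i + j <= n.-1)%N then e_ F n (i + j) else 0 in
  match c with
  | mu11 => base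
  | mu12 => if (i == n) && (j == n) then e_ F n n.-1 else base
  | mu13 => if (i == 1%N) && (j == n) then e_ F n n.-1 else base
  | mu14 => if ((i == 1%N) || (i == n)) && (j == n) then e_ F n n.-1 else base
  end.

Definition mu (F : fieldType) (n : nat) (c : mu_label) : algebra F :=
  table_algebra (@mu_table F n c).

(* Main.v *)
From HB Require Import structures.
Require Import Defs.
From mathcomp Require Import all_boot all_order all_algebra.
From mathcomp Require Import zify ring.
From mathcomp Require Import reals.
From mathcomp Require Import complex.

(* Write A^i for the powers of A. There is x with x^2 outside A^3, and then
   A^i = <x^i> + A^(i+1) for i >= 2, so that x^2, ..., x^(n-1) is a basis of
   A^2. The kernel of u |-> u x has dimension at least 2 but meets <x> + A^2
   in the line <x^(n-1)>; it therefore contains some y outside <x> + A^2.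
   From y x = 0 and associativity, x y and y y are killed by right
   multiplication by x, hence x y = d x^(n-1) and y y = b x^(n-1). Rescaling x
   and y makes d and b equal to 0 or 1, which gives the four models. These are
   told apart by commutativity (d = 0) and by whether every left annihilator
   is a product (b <> 0). *)

Set Implicit Arguments.
Unset Strict Implicit.

Import GRing.Theory.

Local Open Scope ring_scope.
Local Open Scope complex_scope.

Local Notation "x ** y" := (alg_mul x y) (at level 40, left associativity).
Local Arguments table_mul : simpl never.

(** * Adding a line to a subspace *)

Section VectorSpaces.
Variables (K : fieldType) (V : vectType K).
Implicit Types (U W : {vspace V}) (v : V).

Lemma memv_lineD U u v :
  u \in (<[v]> + U)%VS -> exists2 c, u - c *: v \in U & u = c *: v + (u - c *: v).
Proof.
by case/memv_addP=> _ /vlineP[c ->] [w Uw ->]; exists c; rewrite addrAC subrr add0r.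
Qed.

Lemma dim_lineD U v : v \notin U -> \dim (<[v]> + U) = (\dim U).+1.
Proof.
move=> U'v; have v0: v != 0 by apply: contraNneq U'v => ->; exact: mem0v.
rewrite dimv_disjoint_sum ?dim_vline ?v0 //.
apply/eqP; rewrite -subv0; apply/subvP=> w; rewrite memv_cap memv0.
case/andP=> /vlineP[c ->]; have [-> _|c0] := eqVneq c 0; first by rewrite scale0r.
by move/(memvZ c^-1); rewrite scalerK // (negPf U'v).
Qed.

(** A dimension count: [<[v]> + U] lies in [W] and already has dimension [\dim U + 1]. *)
Lemma subv_lineD U W v : (U <= W)%VS -> (\dim W <= (\dim U).+1)%N ->
  v \in W -> v \notin U -> (W <= <[v]> + U)%VS.
Proof.
move=> sUW dimW Wv U'v; have sW: (<[v]> + U <= W)%VS by rewrite subv_add -memvE Wv.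
by rewrite -(geq_leqif (dimv_leqif_sup sW)) dim_lineD.
Qed.

End VectorSpaces.

(** * The descending filtration by powers of an algebra *)

Section Powers.
Variables (K : fieldType) (A : algebra K).
Implicit Types (i j : nat) (u v w x y : A).
Local Notation P := (alg_pow A).

Lemma alg_pow_mul i j u v : (0 < i)%N -> (0 < j)%N ->
  u \in P i -> v \in P j -> u ** v \in P (i + j).
Proof.
case: i => // i _ j0 Pu Pv; rewrite addSn alg_powS ?addn_gt0 ?j0 ?orbT //.
rewrite (bigD1_seq i.+1) ?iota_uniq //=; last first.
  by rewrite mem_index_iota ltnS -addSn -[X in (X < _)%N]addn0 ltn_add2l.
apply: (subvP (addvSl _ _)); move: u v Pu Pv; apply/alg_prodP.
by rewrite -addSn addKn.
Qed.

Lemma alg_pow_ind i (W : {vspace A}) : (0 < i)%N ->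
  (forall k l u v, (0 < k)%N -> (0 < l)%N -> (k + l)%N = i.+1 ->
     u \in P k -> v \in P l -> u ** v \in W) ->
  (P i.+1 <= W)%VS.
Proof.
move=> i0 sW; rewrite alg_powS // big_nat.
elim/big_ind: _ => [|U V sUW sVW|k /andP[k0 ki]]; first exact: sub0v.
  by rewrite subv_add sUW.
apply/alg_prodP=> u v; apply: sW => //; first by rewrite subn_gt0.
by rewrite subnKC // ltnW.
Qed.

(** In a product of total index at least 3 one factor has index at least 2. The induction hypothesis
    lowers the index of that factor by one. *)
Lemma alg_powSS i : (0 < i)%N -> (P i.+1 <= P i)%VS.
Proof.
elim/ltn_ind: i => -[//|[|i]] IHi _; first by rewrite subvf.
apply: alg_pow_ind => // k [//|[|l]] u v k0 _.
  rewrite addn1 => -[->] Pu Pv; rewrite -[i.+2]addn1.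
  by apply: alg_pow_mul => //; apply: (subvP (IHi _ _ _)) Pu.
rewrite addnS => -[kl] Pu Pv; rewrite -kl; apply: alg_pow_mul => //.
apply: (subvP (IHi l.+1 _ _)) => //.
by rewrite -kl -[X in (X < _)%N]add0n ltn_add2r.
Qed.

Lemma alg_pow_anti i j : (0 < i)%N -> (i <= j)%N -> (P j <= P i)%VS.
Proof.
move=> i0 /subnKC<-; elim: (j - i)%N => [|k IHk]; first by rewrite addn0.
by rewrite addnS (subv_trans (alg_powSS _)) // addn_gt0 i0.
Qed.

Lemma alg_pow2_mul u v : u ** v \in P 2.
Proof. by apply: (alg_pow_mul (i := 1) (j := 1)); rewrite ?memvf. Qed.

Definition rmul x : 'End(A) := linfun (applyr (@alg_mul _ A) x).

Lemma rmulE x u : rmul x u = u ** x.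
Proof. by rewrite lfunE. Qed.

Hypothesis mulA : alg_assoc A.

(** Associativity reduces A^(i+1) to the products A A^i: rewriting (a b) v as a (b v) shortens the
    left factor until it has index 1. *)
Lemma alg_powS_ind i (W : {vspace A}) : (0 < i)%N ->
  (forall a u, u \in P i -> a ** u \in W) -> (P i.+1 <= W)%VS.
Proof.
move=> i0 sW; apply: alg_pow_ind => // k; elim/ltn_ind: k => -[//|[|k]] IHk l u v _ l0.
  by rewrite add1n => -[->] _; apply: sW.
move=> kl Pu Pv.
(* With [v] fixed, the goal says that [u] lies in the preimage of [W] under right multiplication by
   [v]. This is a subspace, so it is enough to treat products [u] = a b. *)
rewrite -(rmulE v u) memv_preim; move: u Pu; apply/subvP.
apply: alg_pow_ind => // k' [//|l'] a b k'0 _ kl' Pa Pb; rewrite -memv_preim rmulE -mulA.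
apply: (IHk k' _ (l'.+1 + l)%N) => //; first by rewrite -kl' -[X in (X < _)%N]addn0 ltn_add2l.
- by rewrite addnA kl'.
- exact: alg_pow_mul.
Qed.

End Powers.

(** * Powers of an element, and squares in filiform algebras *)

Section Filiform.
Variables (K : fieldType) (A : algebra K).
Hypothesis mulA : alg_assoc A.
Implicit Types (i j k : nat) (u v w x y : A).
Local Notation P := (alg_pow A).

(* x ^ k for k >= 1; the value at k = 0 is junk. *)
Definition ppow x k : A := iter k.-1 (rmul x) x.

Lemma ppowS x k : (0 < k)%N -> ppow x k.+1 = ppow x k ** x.
Proof. by case: k => // k _; rewrite /ppow /= rmulE. Qed.

Lemma ppowM x i j : (0 < i)%N -> (0 < j)%N -> ppow x i ** ppow x j = ppow x (i + j).
Proof.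
move=> i0; elim: j => // -[_ _|j IHj _]; first by rewrite addn1 (ppowS _ i0).
by rewrite (ppowS _ (ltn0Sn j)) mulA IHj // -ppowS ?addn_gt0 ?i0 // !addnS.
Qed.

Lemma ppowZ c x k : (0 < k)%N -> ppow (c *: x) k = c ^+ k *: ppow x k.
Proof.
elim: k => // -[_ _|k IHk _]; first by rewrite expr1.
by rewrite ppowS // IHk // linearZl_LR linearZr_LR scalerA -exprSr -ppowS.
Qed.

Lemma mem_ppow x k : (0 < k)%N -> ppow x k \in P k.
Proof.
elim: k => // -[_ _|k IHk _]; first exact: memvf.
by rewrite ppowS // -[k.+2]addn1 alg_pow_mul // ?memvf // IHk.
Qed.

(** For the inductive step write a x^i = (a x^(i-1)) x. Here a x^(i-1) lies in A^i, hence in <x^i> +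
    A^(i+1), and right multiplication by x carries this into <x^(i+1)> + A^(i+2). *)
Lemma alg_pow_line x i : (P 2 <= <[x ** x]> + P 3)%VS -> (1 < i)%N ->
  (P i <= <[ppow x i]> + P i.+1)%VS.
Proof.
move=> P2; elim: i => // -[//|[|i]] IHi _; first by rewrite [ppow x 2]rmulE.
move/(_ isT): IHi => IHi.
apply: alg_powS_ind => // a u /(subvP IHi) /memv_lineD[c Pw ->].
rewrite linearDr linearZr_LR memvD ?memvZ //; last first.
  by apply: (subvP (addvSr _ _)); apply: (alg_pow_mul (i := 1)); rewrite ?memvf.
have -> : a ** ppow x i.+2 = (a ** ppow x i.+1) ** x by rewrite ppowS // mulA.
have /(subvP IHi) : a ** ppow x i.+1 \in P i.+2.
  by apply: (alg_pow_mul (i := 1)); rewrite ?memvf // mem_ppow.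
case/memv_lineD=> c' Pw' ->; rewrite linearDl linearZl_LR -ppowS //.
apply: memv_add; first by rewrite memvZ // memv_line.
by rewrite -[i.+4]addn1 alg_pow_mul // memvf.
Qed.

Variable n : nat.
Hypotheses (hn : (3 < n)%N) (dimA : alg_dim A = n) (filA : filiform A).

Lemma dim_filiform i : (1 < i <= n)%N -> \dim (P i) = (n - i)%N.
Proof. by rewrite -{1}dimA => /filA ->; rewrite dimA. Qed.

Lemma filiform_pow0 i : (n <= i)%N -> P i = 0%VS.
Proof.
move=> ni; apply/eqP; rewrite -subv0; apply: (@subv_trans _ _ (P n)).
  by rewrite alg_pow_anti //; lia.
by rewrite subv0 -dimv_eq0 dim_filiform ?subnn //; lia.
Qed.

Lemma ppow0 x i : (n <= i)%N -> ppow x i = 0.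
Proof.
move=> ni; apply/eqP; rewrite -memv0 -(filiform_pow0 ni) mem_ppow //; lia.
Qed.

Lemma filiform_neq i : (1 < i < n)%N -> ~~ (P i <= P i.+1)%VS.
Proof.
move=> lt_in; apply/negP=> /dimvS; rewrite !dim_filiform; lia.
Qed.

(* If v v lies in A^3 then so does every u v: otherwise A^2 = <u v> + A^3,
   and a (u v) = (a u) v lies in <u (v v)> + A^4 = A^4, whence A^3 = A^4. *)
Lemma filiform_mul_sqr u v : v ** v \in P 3 -> u ** v \in P 3.
Proof.
move=> Pvv; apply: contraLR (@filiform_neq 3 _) => // Nuv; rewrite negbK.
have P2 : (P 2 <= <[u ** v]> + P 3)%VS.
  apply: subv_lineD; rewrite ?alg_powSS ?alg_pow2_mul //.
  by rewrite !dim_filiform; lia.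
apply: alg_powS_ind => // a w /(subvP P2) /memv_lineD[c Pw ->].
rewrite linearDr linearZr_LR memvD ?memvZ //; last first.
  by apply: (alg_pow_mul (i := 1)); rewrite ?memvf.
rewrite mulA; have /(subvP P2) /memv_lineD[c' Pw' ->] := alg_pow2_mul a u.
rewrite linearDl linearZl_LR -mulA memvD ?memvZ //.
  by apply: (alg_pow_mul (i := 1)); rewrite ?memvf.
by apply: (alg_pow_mul (i := 3) (j := 1)); rewrite ?memvf.
Qed.

(** Since A^2 is not contained in A^3, some product u v of basis vectors lies outside A^3; by the
    previous lemma so does v v. *)
Lemma filiform_ex_sqr : exists x, x ** x \notin P 3.
Proof.
have : ~~ (P 2 <= P 3)%VS by apply: filiform_neq; lia.
rewrite alg_powS // big_nat1 => /subvPn[w].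
rewrite /alg_prod !alg_pow1.
have [/allP all3|/allPn[_ /allpairsP[[u v] /= [_ _ ->]] Nuv]] :=
  boolP (all [in P 3] [seq u ** v | u <- vbasis {: A}, v <- vbasis {: A}]).
  by move/span_subvP: all3 => /subvP sP /sP ->.
by exists v; apply: contra Nuv; apply: filiform_mul_sqr.
Qed.

(** * Consequences of an element whose square lies outside A^3 *)

Section Generator.
Variable x : A.
Hypothesis Nxx : x ** x \notin P 3.

Lemma filiform_line i : (1 < i)%N -> (P i <= <[ppow x i]> + P i.+1)%VS.
Proof.
apply: alg_pow_line; apply: subv_lineD; rewrite ?alg_powSS ?alg_pow2_mul //.
by rewrite !dim_filiform; lia.
Qed.

(** For i >= 2, x^i spans A^i modulo A^(i+1), and these two powers differ. For i = 1, having x in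
    A^2 would put x x in A^3. *)
Lemma ppow_notin i : (0 < i < n)%N -> ppow x i \notin P i.+1.
Proof.
case: i => [|[|i]] // lt_in.
  apply: contra Nxx => Px; apply: (alg_pow_mul (i := 2) (j := 1)) => //.
  exact: memvf.
apply: contra (@filiform_neq i.+2 _) => // Px.
by rewrite (subv_trans (@filiform_line i.+2 _)) // subv_add subvv -memvE Px.
Qed.

(** Write u = c x^i + w with w in A^(i+1). If i + 1 < n, then u x = 0 puts c x^(i+1) in A^(i+2), so
    c = 0 and u moves one step down the filtration. The descent stops at i = n-1, where A^n = 0. *)
Lemma rmul_ker_line i u : (0 < i < n)%N -> u \in (<[ppow x i]> + P i.+1)%VS ->
  u ** x = 0 -> u \in <[ppow x n.-1]>%VS.
Proof.
move=> lt_in Pu ux0; move: lt_in Pu.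
have [k] := ubnP (n - i); elim: k i => // k IHk i lt_k lt_in.
have [ni|lt_iSn] := leqP n i.+1.
  have -> : i = n.-1 by lia.
  by rewrite filiform_pow0 ?addv0 //; lia.
case/memv_lineD=> c Pw Du.
have c0: c = 0.
  apply: contraNeq (@ppow_notin i.+1 _) => [c0|]; last by lia.
  have: c *: ppow x i.+1 = - ((u - c *: ppow x i) ** x).
    by rewrite linearBl ux0 sub0r opprK linearZl_LR ppowS //; lia.
  move/(congr1 (fun v => c^-1 *: v)); rewrite scalerK // => ->.
  rewrite memvZ // memvN -[i.+2]addn1 alg_pow_mul //; first exact: memvf.
move: Pw; rewrite c0 scale0r subr0 => Pu.
apply: IHk (subvP (@filiform_line i.+1 _) _ Pu); lia.
Qed.

Lemma dim_lineD_pow2 : \dim (<[x]> + P 2) = n.-1.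
Proof.
rewrite dim_lineD; first by rewrite dim_filiform; lia.
by apply: (@ppow_notin 1); lia.
Qed.

Lemma filiform_complement : exists2 y, y \notin (<[x]> + P 2)%VS & y ** x = 0.
Proof.
have : ~~ (lker (rmul x) <= <[x]> + P 2)%VS.
  apply/negP=> sK.
  have sL : (lker (rmul x) <= <[ppow x n.-1]>)%VS.
    apply/subvP=> u Ku; apply: (@rmul_ker_line 1) (subvP sK u Ku) _; first lia.
    by apply/eqP; rewrite -rmulE -memv_ker.
  (* Rank-nullity: the image lies in A^2, of dimension n-2, so the kernel has dimension at least 2
     and does not fit in a line. *)
  have := limg_ker_dim (rmul x) fullv; rewrite capfv -/(alg_dim A) dimA.
  have /dimvS : (rmul x @: fullv <= P 2)%VS.
    by apply/subvP=> _ /memv_imgP[u _ ->]; rewrite rmulE alg_pow2_mul.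
  move/dimvS: sL; rewrite dim_vline dim_filiform; last by lia.
  by case: (_ != _) => /=; lia.
case/subvPn=> y; rewrite memv_ker rmulE => /eqP yx0 Qy.
by exists y.
Qed.

(** The product v y lies in A^2, and (v y) x = v (y x) = 0, so the kernel lemma applies from i =
    2. *)
Lemma mul_complement_line y v : y ** x = 0 -> exists c, v ** y = c *: ppow x n.-1.
Proof.
move=> yx0; apply/vlineP; apply: (@rmul_ker_line 2); first lia.
  by apply: (subvP (filiform_line _)) => //; exact: alg_pow2_mul.
by rewrite -mulA yx0 linear0r.
Qed.

Variable y : A.
Hypothesis Qy : y \notin (<[x]> + P 2)%VS.

Definition filiform_basis k := if (k < n)%N then ppow x k else y.

(** There are n vectors, so spanning suffices. Descending the filtration puts A^2 in the span; then
    <x> + A^2 is a hyperplane in the span, and y lies off it. *)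
Lemma filiform_basisP :
  basis_of fullv [tuple filiform_basis i.+1 | i < n].
Proof.
rewrite basisEdim size_tuple -/(alg_dim A) dimA leqnn andbT.
set X := tval _.
have memX k : (0 < k <= n)%N -> filiform_basis k \in <<X>>%VS.
  case: k => // k lt_kn; apply: memv_span; apply/mapP.
  by exists (Ordinal lt_kn); rewrite // mem_enum.
have memp k : (0 < k < n)%N -> ppow x k \in <<X>>%VS.
  by move=> lt_kn; have := memX k; rewrite /filiform_basis ifT; [apply|]; lia.
have sP i : (1 < i)%N -> (P i <= <<X>>)%VS.
  have [k] := ubnP (n - i); elim: k i => // k IHk i lt_k i1.
  have [ni|lt_in] := leqP n i; first by rewrite filiform_pow0 // sub0v.
  rewrite (subv_trans (filiform_line _)) // subv_add -memvE memp ?IHk //; lia.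
have sQ : (<[x]> + P 2 <= <<X>>)%VS by rewrite subv_add -memvE (memp 1) ?sP //; lia.
apply: (@subv_trans _ _ (<[y]> + (<[x]> + P 2))%VS).
  apply: subv_lineD; rewrite ?subvf ?memvf //.
  by rewrite dim_lineD_pow2 -/(alg_dim A) dimA; lia.
rewrite subv_add sQ andbT -memvE.
have := memX n; rewrite /filiform_basis ltnn; apply; lia.
Qed.

End Generator.
End Filiform.

(** * Algebras given by structure constants *)

Lemma alg_assoc_span (K : fieldType) n (A : algebra K) (b : 'I_n -> A) :
  (forall u, exists c, u = \sum_i c i *: b i) ->
  (forall i j k, b i ** (b j ** b k) = b i ** b j ** b k) -> alg_assoc A.
Proof.
move=> spanA bA u v w; have [c ->] := spanA u.
rewrite !linear_sumlz; apply: eq_bigr => i _; rewrite !linearZl_LR /=; congr (_ *: _).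
have [d ->] := spanA v; rewrite linear_sumlz !linear_sumr linear_sumlz.
apply: eq_bigr => j _; rewrite linearZr_LR !linearZl_LR linearZr_LR /=; congr (_ *: _).
have [f ->] := spanA w; rewrite !linear_sumr; apply: eq_bigr => k _.
by rewrite !linearZr_LR bA.
Qed.

Section Tables.
Variables (K : fieldType) (n : nat).
Implicit Types (T : nat -> nat -> 'rV[K]_n).

Lemma row_sum_e (v : 'rV[K]_n) : v = \sum_(i < n) v 0 i *: e_ K n i.+1.
Proof.
apply/rowP=> j; rewrite summxE (bigD1 j) //= big1 => [|i ne_ij].
  by rewrite !mxE eqxx mulr1 addr0.
by rewrite !mxE eqSS (negPf (_ : (j : nat) != i)) ?mulr0 // eq_sym.
Qed.

Lemma sum_e (V : lmodType K) (b : nat -> V) m : (0 < m <= n)%N ->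
  \sum_(k < n) (e_ K n m) 0 k *: b k.+1 = b m.
Proof.
case: m => // m lt_mn; rewrite (bigD1 (Ordinal lt_mn)) //= big1 => [|i ne_i].
  by rewrite !mxE eqxx scale1r addr0.
by rewrite !mxE eqSS (negPf (ne_i : (i : nat) != m)) scale0r.
Qed.

Lemma table_mulr T (u : 'rV[K]_n) j : (0 < j <= n)%N ->
  table_mul T u (e_ K n j) = \sum_(i < n) u 0 i *: T i.+1 j.
Proof.
move=> jn; rewrite /table_mul; apply: eq_bigr => i _.
rewrite -(@sum_e _ (T i.+1) j jn) scaler_sumr; apply: eq_bigr => k _.
by rewrite scalerA.
Qed.

Lemma table_assoc T :
  (forall i j k, (0 < i <= n)%N -> (0 < j <= n)%N -> (0 < k <= n)%N ->
     table_mul T (e_ K n i) (T j k) = table_mul T (T i j) (e_ K n k)) ->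
  alg_assoc (table_algebra T).
Proof.
move=> TA; apply: (@alg_assoc_span _ n _ (fun i => e_ K n i.+1 : table_algebra T)).
  by move=> u; exists (u 0); apply: row_sum_e.
by move=> i j k; rewrite /= !table_mul_e ?ltn_ord // TA ?ltn_ord.
Qed.

Lemma table_comm T :
  (forall i j, (0 < i <= n)%N -> (0 < j <= n)%N -> T i j = T j i) ->
  forall u v, table_mul T u v = table_mul T v u.
Proof.
move=> TC u v; rewrite /table_mul exchange_big; apply: eq_bigr => j _.
by apply: eq_bigr => i _; rewrite mulrC TC /=.
Qed.

Lemma alg_dim_table T : alg_dim (table_algebra T) = n.
Proof. by rewrite /alg_dim dimvf /dim /= mul1n. Qed.

(** The isomorphism takes coordinates in the basis [b]. Multiplicativity is checked on its inverse
    [g], an explicit linear combination, and then transported. *)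
Lemma alg_iso_table (A : algebra K) T (b : nat -> A) :
  basis_of fullv [tuple b i.+1 | i < n] ->
  (forall i j, (0 < i <= n)%N -> (0 < j <= n)%N ->
     b i ** b j = \sum_(k < n) T i j 0 k *: b k.+1) ->
  alg_iso A (table_algebra T).
Proof.
set X := [tuple _ | _ < _] => bX bT.
have Xi (i : 'I_n) : X`_i = b i.+1 by rewrite nth_mktuple.
pose g (v : 'rV[K]_n) : A := \sum_(k < n) v 0 k *: b k.+1.
pose f (u : A) : 'rV[K]_n := \row_k coord X k u.
have fg : cancel f g.
  move=> u; rewrite [RHS](coord_basis bX) ?memvf //; apply: eq_bigr => k _.
  by rewrite mxE Xi.
have gf : cancel g f.
  move=> v; apply/rowP=> k; rewrite mxE /g.
  have -> : \sum_(k < n) v 0 k *: b k.+1 = \sum_(k < n) v 0 k *: X`_k.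
    by apply: eq_bigr => i _; rewrite Xi.
  by rewrite coord_sum_free // (basis_free bX).
have gM u v : g (table_mul T u v) = g u ** g v.
  rewrite /g linear_sumlz /=.
  under eq_bigr => k _ do rewrite summxE scaler_suml.
  rewrite exchange_big; apply: eq_bigr => i _ /=.
  rewrite linearZl_LR linear_sumr scaler_sumr /=.
  under eq_bigr => k _ do rewrite summxE scaler_suml.
  rewrite exchange_big; apply: eq_bigr => j _ /=.
  rewrite linearZr_LR /= bT ?ltn_ord // !scaler_sumr.
  by apply: eq_bigr => k _; rewrite !mxE !scalerA.
have fL : linear f by move=> c u v; apply/rowP=> k; rewrite !mxE linearP.
pose fP := GRing.isLinear.Build K A (table_algebra T) *:%R f fL.
pose fl : {linear A -> table_algebra T} := HB.pack f fP.
exists fl; first by exists g.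
by move=> u v; apply: (can_inj gf); rewrite /= gM !fg.
Qed.

End Tables.

(** * The four models: associativity, filiformity, recognition *)

Section Models.
Variables (K : fieldType) (n : nat).
Hypothesis hn : (3 < n)%N.
Local Notation e := (e_ K n).
Local Notation T := (@mu_table K n).

(** The label is encoded by two independent bits: whether e_1 e_n, respectively e_n e_n, equals
    e_(n-1) or 0. The vectors e_1 and e_n play the roles of x and y. *)
Definition mu_xy c : bool := match c with mu13 | mu14 => true | _ => false end.
Definition mu_yy c : bool := match c with mu12 | mu14 => true | _ => false end.

Lemma mu_tableE c i j : (0 < i <= n)%N -> (0 < j <= n)%N -> T c i j =
  if (i + j <= n.-1)%N then e (i + j) else
  ((j == n) && ((i == 1%N) && mu_xy c || (i == n) && mu_yy c))%:R *: e n.-1.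
Proof.
move=> i0 j0; rewrite /mu_table; have [ij|ij] := leqP.
  have -> : (j == n) = false by lia.
  by rewrite !andbF; case: c.
by case: c; rewrite /= ?andbF ?andbT ?orbF /= ?scale0r // andbC;
  case: ifP; rewrite ?scale1r ?scale0r.
Qed.

Lemma mu_mul_top c j : (0 < j <= n)%N -> table_mul (T c) (e n.-1) (e j) = 0.
Proof.
move=> j0; rewrite table_mul_e ?mu_tableE; try lia.
rewrite ifN; last by lia.
have [-> ->] : (n.-1 == 1%N) = false /\ (n.-1 == n) = false by lia.
by rewrite andbF scale0r.
Qed.

Lemma mu_top_mul c i : (0 < i <= n)%N -> table_mul (T c) (e i) (e n.-1) = 0.
Proof.
move=> i0; rewrite table_mul_e ?mu_tableE; try lia.
rewrite ifN; last by lia.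
have -> : (n.-1 == n) = false by lia.
by rewrite scale0r.
Qed.

(** The exceptional products are multiples of e_(n-1), which is annihilated on both sides. Triple
    products therefore do not depend on [c], and both bracketings give the same value. *)
Lemma mu_mul3r c i j k : (0 < i <= n)%N -> (0 < j <= n)%N -> (0 < k <= n)%N ->
  table_mul (T c) (e i) (T c j k) =
  if (i + j + k <= n.-1)%N then e (i + j + k) else 0.
Proof.
move=> i0 j0 k0; rewrite [T c j k]mu_tableE //; case: leqP => jk; last first.
  by rewrite linearZr_LR /= mu_top_mul // scaler0 ifN //; lia.
rewrite table_mul_e ?mu_tableE ?addnA //; try lia.
case: ifP => // _; have -> : (j + k == n)%N = false by lia.
by rewrite scale0r.
Qed.

Lemma mu_mul3l c i j k : (0 < i <= n)%N -> (0 < j <= n)%N -> (0 < k <= n)%N ->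
  table_mul (T c) (T c i j) (e k) =
  if (i + j + k <= n.-1)%N then e (i + j + k) else 0.
Proof.
move=> i0 j0 k0; rewrite [T c i j]mu_tableE //; case: leqP => ij; last first.
  by rewrite linearZl_LR /= mu_mul_top // scaler0 ifN //; lia.
rewrite table_mul_e ?mu_tableE //; try lia.
case: ifP => // _; have [-> ->] : (i + j == n)%N = false /\ (i + j == 1)%N = false by lia.
by rewrite andbF scale0r.
Qed.

Lemma mu_assoc c : alg_assoc (mu K n c).
Proof. by apply: table_assoc => i j k i0 j0 k0; rewrite mu_mul3r // mu_mul3l. Qed.

Lemma e_mem_mu_pow c k : (0 < k < n)%N -> (e k : mu K n c) \in alg_pow (mu K n c) k.
Proof.
elim: k => // -[_ _|k IHk lt_kn]; first exact: memvf.
have -> : e k.+2 = alg_mul (e k.+1 : mu K n c) (e 1).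
  rewrite /= table_mul_e ?mu_tableE; try lia.
  by rewrite addn1 ifT //; lia.
by rewrite -[k.+2]addn1 alg_pow_mul ?memvf ?IHk //; lia.
Qed.

(** The list runs over e_i, ..., e_(n-1). No product has a component on e_1 or e_n, which settles i
    = 2. Afterwards the right factor is some e_k with k < n, so the exceptional products, whose
    right factor is e_n, do not occur and each index rises. *)
Lemma mu_pow_sub c i : (1 < i)%N ->
  (alg_pow (mu K n c) i <= <<[seq e k : mu K n c | k <- iota i (n - i)]>>)%VS.
Proof.
have topP j m : (1 < j)%N -> (j <= m < n)%N ->
    (e m : mu K n c) \in <<[seq e k : mu K n c | k <- iota j (n - j)]>>%VS.
  by move=> j1 jm; apply/memv_span/map_f; rewrite mem_iota; lia.
elim: i => // -[//|[|i]] IHi _.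
  apply: alg_powS_ind => // [|a u _]; first exact: mu_assoc.
  rewrite /= /table_mul rpred_sum // => i _; rewrite rpred_sum // => j _.
  rewrite memvZ //; have := ltn_ord i; have := ltn_ord j => lj li.
  rewrite mu_tableE; try lia.
  by case: ifP => [le_ij|_]; rewrite ?memvZ // topP //; lia.
apply: alg_powS_ind => // [|a u]; first exact: mu_assoc.
move=> /(subvP (IHi isT)); rewrite -(lfunE (alg_mul a) u) memv_preim.
move: u; apply/subvP/span_subvP=> _ /mapP[k + ->]; rewrite mem_iota => lt_k.
rewrite -memv_preim lfunE /= table_mulr; last by lia.
rewrite rpred_sum // => j _; rewrite memvZ //; have := ltn_ord j => lj.
rewrite mu_tableE; try lia.
case: ifP => le_jk; first by rewrite topP //; lia.
have -> : (k == n) = false by lia.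
by rewrite scale0r mem0v.
Qed.

Lemma free_e i : (0 < i <= n)%N -> free [seq e k | k <- iota i (n - i)].
Proof.
move=> lt_in; have : free [seq e k | k <- iota 1 n].
  apply/(@basis_free _ _ fullv); rewrite basisEdim size_map size_iota.
  rewrite dimvf /dim /= mul1n leqnn andbT; apply/subvP=> u _.
  rewrite (row_sum_e u) rpred_sum // => j _; rewrite memvZ //.
  by apply/memv_span/map_f; rewrite mem_iota; have := ltn_ord j; lia.
(* Cut 1, ..., n into 1, ..., i-1, then i, ..., n-1, then n; the middle segment inherits
   freeness. *)
have Dn : n = (i.-1 + (n - i + 1))%N by lia.
rewrite [iota 1 n](congr1 (iota 1) Dn) !iotaD (_ : (1 + i.-1)%N = i); last by lia.
by rewrite !map_cat !cat_free => /and3P[_ /and3P[]].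
Qed.

Lemma mu_filiform c : filiform (mu K n c).
Proof.
move=> i; rewrite alg_dim_table => /andP[i1 le_in].
have /eqP dimW : free [seq e k | k <- iota i (n - i)] by apply: free_e; lia.
have -> : alg_pow (mu K n c) i = <<[seq e k : mu K n c | k <- iota i (n - i)]>>%VS.
  apply/eqP; rewrite eqEsubv mu_pow_sub //=; apply/span_subvP=> _ /mapP[k + ->].
  rewrite mem_iota => lt_k; apply: (subvP (@alg_pow_anti _ (mu K n c) i k _ _)); try lia.
  by apply: e_mem_mu_pow; lia.
by rewrite [LHS]dimW size_map size_iota.
Qed.

(** Recognition criterion: the values of y x, x y and y y determine the whole table in the basis x,
    ..., x^(n-1), y. *)
Lemma alg_iso_mu (A : algebra K) (x y : A) c : alg_assoc A -> alg_dim A = n -> filiform A ->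
  x ** x \notin alg_pow A 3 -> y \notin (<[x]> + alg_pow A 2)%VS ->
  y ** x = 0 -> x ** y = (mu_xy c)%:R *: ppow x n.-1 ->
  y ** y = (mu_yy c)%:R *: ppow x n.-1 -> alg_iso A (mu K n c).
Proof.
move=> mulA dimA filA Nxx Qy yx xy yy.
apply: (alg_iso_table (filiform_basisP mulA hn dimA filA Nxx Qy)) => i j i0 j0.
have be k : (0 < k <= n.-1)%N -> filiform_basis n x y k = ppow x k.
  by move=> k0; rewrite /filiform_basis ifT //; lia.
have -> : \sum_(k < n) T c i j 0 k *: filiform_basis n x y k.+1 =
    if (i + j <= n.-1)%N then ppow x (i + j) else
    ((j == n) && ((i == 1%N) && mu_xy c || (i == n) && mu_yy c))%:R *: ppow x n.-1.
  rewrite mu_tableE //; case: ifP => ij.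
    by rewrite sum_e ?be //; lia.
  under eq_bigr => k _ do rewrite mxE -scalerA.
  by rewrite -scaler_sumr sum_e ?be //; lia.
have p0 k : (n <= k)%N -> ppow x k = 0 by apply: ppow0.
have yp k : (0 < k)%N -> y ** ppow x k = 0.
  elim: k => // -[|k] IHk _; first exact: yx.
  by rewrite ppowS // mulA IHk // linear0l.
have [jn|jn] := eqVneq j n; last first.
  have lt_jn : (j < n)%N by lia.
  rewrite scale0r {2}/filiform_basis lt_jn; have [->|ni] := eqVneq i n.
    by rewrite /filiform_basis ltnn yp ?ifN //; lia.
  have lt_in : (i < n)%N by lia.
  rewrite /filiform_basis lt_in ppowM //; try lia.
  by case: leqP => // ?; rewrite p0 //; lia.
rewrite ifN jn; last by lia.
have [->|ni] := eqVneq i n.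
  have -> : (n == 1)%N = false by lia.
  by rewrite /filiform_basis ltnn.
have lt_in : (i < n)%N by lia.
rewrite orbF /filiform_basis ltnn lt_in; have [->|ni1] := eqVneq i 1%N; first exact: xy.
(* For i >= 2, x^i y = x^(i-1) (x y) is a multiple of x^(i-1) x^(n-1), which vanishes because its
   exponent is at least n. *)
have -> : i = i.-1.+1 by lia.
rewrite ppowS; last by lia.
rewrite -mulA xy linearZr_LR ppowM // ?[ppow x (_ + _)]p0 ?scaler0 ?scale0r //; lia.
Qed.

End Models.

(** * Normalization over an algebraically closed field *)

Section Classification.
Variables (K : closedFieldType) (n : nat).
Hypothesis hn : (3 < n)%N.

Lemma closed_root (m : nat) (a : K) : (0 < m)%N -> exists r, r ^+ m = a.
Proof.
move=> m0; have [r rE] := @GRing.solve_monicpoly K m (fun k => a *+ (k == 0)%N) m0.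
exists r; rewrite rE -(prednK m0) big_ord_recl big1 /= ?expr0 ?mulr1 ?addr0 // => k _.
by rewrite mulr0n mul0r.
Qed.

(* With x y = d x^(n-1) and y y = b x^(n-1), replacing x, y by s x, t y turns
   (d, b) into (t d / s^(n-2), t^2 b / s^(n-1)); making both equal to 1 when
   d, b <> 0 amounts to s^(n-3) = d^2 / b, which needs n > 3. *)
Lemma mu_scaling (d b : K) : exists (s t : K) c,
  [/\ s != 0, t != 0, s * t * d = (mu_xy c)%:R * s ^+ n.-1
    & t * t * b = (mu_yy c)%:R * s ^+ n.-1].
Proof.
have [->|d0] := eqVneq d 0; have [->|b0] := eqVneq b 0.
- by exists 1, 1, mu11; rewrite !oner_neq0 !mulr0 !mul0r.
- have [t tb] := @closed_root 2 b^-1 isT.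
  exists 1, t, mu12; rewrite oner_neq0 mulr0 mul0r expr1n mulr1 -expr2 tb mulVf //.
  by split=> //; apply: contraNneq b0 => t0; rewrite -invr_eq0 -tb t0 expr0n.
- exists 1, d^-1, mu13.
  by rewrite oner_neq0 invr_eq0 d0 mul1r mulVf // expr1n !mulr0 !mul0r mulr1.
have m0 : (0 < n - 3)%N by lia.
have [s sE] := closed_root (d ^+ 2 / b) m0.
have s0 : s != 0.
  apply: contraTneq isT => s0; move: sE; rewrite s0 expr0n (gtn_eqF m0) => /esym/eqP.
  by rewrite mulf_eq0 invr_eq0 sqrf_eq0 (negPf d0) (negPf b0).
exists s, (s ^+ (n - 2) / d), mu14; rewrite mulf_neq0 ?expf_neq0 ?invr_eq0 // !mul1r.
split=> //; first by rewrite mulrA mulfVK // -exprS; congr (_ ^+ _); lia.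
have -> : (n.-1 = (n - 2) + 1)%N by lia.
rewrite exprD expr1 -mulrA -mulrA; congr (_ * _).
have -> : (n - 2 = (n - 3) + 1)%N by lia.
rewrite exprD expr1 sE; field.
by rewrite d0 b0.
Qed.

Lemma filiform_classification (A : algebra K) :
  alg_assoc A -> alg_dim A = n -> filiform A -> exists c, alg_iso A (mu K n c).
Proof.
move=> mulA dimA filA.
have [x Nxx] := filiform_ex_sqr mulA hn dimA filA.
have [y Qy yx] := filiform_complement mulA hn dimA filA Nxx.
have [d xy] := mul_complement_line mulA hn dimA filA Nxx x yx.
have [b yy] := mul_complement_line mulA hn dimA filA Nxx y yx.
have [s [t [c [s0 t0 sd tb]]]] := mu_scaling d b.
(* Rescaling by nonzero scalars preserves both conditions: x x outside A^3 and y outside <x> +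
   A^2. *)
have memZ (U : {vspace A}) a u : a != 0 -> (a *: u \in U) = (u \in U).
  move=> a0; apply/idP/idP => [/(memvZ a^-1)|]; first by rewrite scalerK.
  exact: memvZ.
have lineZ : (<[s *: x]> = <[x]>)%VS.
  apply/eqP; rewrite eqEsubv -!memvE memvZ ?memv_line //=.
  by rewrite -(memZ _ s) // memv_line.
exists c; apply: (@alg_iso_mu _ _ hn A (s *: x) (t *: y)) => //.
- by rewrite linearZl_LR linearZr_LR /= !memZ.
- by rewrite lineZ memZ.
- by rewrite linearZl_LR linearZr_LR /= yx !scaler0.
- rewrite linearZl_LR linearZr_LR /= xy ppowZ ?scalerA ?sd //; lia.
- rewrite linearZl_LR linearZr_LR /= yy ppowZ ?scalerA ?tb //; lia.
Qed.

End Classification.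

(** * Two isomorphism invariants separating the models *)

Section Invariants.
Variable K : fieldType.

Definition commutative_alg (A : algebra K) := forall x y : A, x ** y = y ** x.

Definition annihilators_are_products (A : algebra K) :=
  forall v : A, (forall w, v ** w = 0) -> exists u w, v = u ** w.

Lemma iso_commutative (A B : algebra K) :
  alg_iso A B -> commutative_alg A <-> commutative_alg B.
Proof.
case=> f [g fK gK] fM; split=> C x y; last by apply: (can_inj fK); rewrite !fM.
by rewrite -(gK x) -(gK y) -!fM C.
Qed.

Lemma iso_annihilators_are_products (A B : algebra K) : alg_iso A B ->
  annihilators_are_products A <-> annihilators_are_products B.
Proof.
case=> f [g fK gK] fM; split=> H v v0.
  have [|u [w gv]] := H (g v); last by exists (f u), (f w); rewrite -fM -gv gK.
  by move=> w; apply: (can_inj fK); rewrite fM gK v0 linear0.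
have [|u [w fv]] := H (f v); last first.
  by exists (g u), (g w); apply: (can_inj fK); rewrite fM !gK.
by move=> w; rewrite -[w]gK -fM v0 linear0.
Qed.

Variable n : nat.
Hypothesis hn : (3 < n)%N.
Local Notation e := (e_ K n).
Local Notation T := (@mu_table K n).

Lemma e_coord m (j : 'I_n) : e m 0 j = (j.+1 == m)%:R.
Proof. by rewrite mxE. Qed.

Lemma e_neq0 m : (0 < m <= n)%N -> e m != 0.
Proof.
case: m => // m lt_mn; apply/eqP => /rowP/(_ (Ordinal lt_mn)).
by rewrite !mxE eqxx => /eqP; rewrite oner_eq0.
Qed.

(** As e_n e_1 = 0 in every model, the pair e_1, e_n is the only one that can fail to commute. *)
Lemma mu_commutative c : commutative_alg (mu K n c) <-> ~~ mu_xy c.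
Proof.
split=> [C|Nxy].
  have := C (e 1) (e n); rewrite /= !table_mul_e; try lia.
  rewrite !mu_tableE; try lia.
  rewrite !ifN; try lia.
  have [-> ->] : (1 == n)%N = false /\ (n == 1)%N = false by lia.
  rewrite !eqxx /= orbF scale0r; case: mu_xy => //= /eqP.
  by rewrite scale1r (negPf (e_neq0 _)) //; lia.
apply: table_comm => i j i0 j0; rewrite !mu_tableE // addnC; case: ifP => // _.
by rewrite (negPf Nxy) !andbF /= !andbA [(j == n) && _]andbC.
Qed.

(** If e_n e_n = 0, then e_n is a left annihilator, yet no product has a component on e_n. Otherwise
    v e_1 = 0 and v e_n = 0 force v into the line of e_(n-1) = e_1 e_(n-2). *)
Lemma mu_annihilators_are_products c :
  annihilators_are_products (mu K n c) <-> mu_yy c.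
Proof.
have lt_n1 : (n.-1 < n)%N by lia.
have lt_n2 : (n - 2 < n)%N by lia.
have [H|Nyy] := boolP (mu_yy c); last first.
  split=> // /(_ (e n)) []; last first.
    move=> u [w] /rowP/(_ (Ordinal lt_n1)); rewrite !mxE /=.
    rewrite prednK ?eqxx; last by lia.
    rewrite summxE big1 => [/eqP|i _]; first by rewrite oner_eq0.
    rewrite summxE big1 // => j _; rewrite mxE mu_tableE ?ltn_ord //.
    case: ifP => ij; rewrite !mxE /= (_ : (n.-1.+1 == _) = false) ?mulr0 //; lia.
  move=> w; rewrite (row_sum_e w) linear_sumr /= big1 // => j _.
  rewrite linearZr_LR /= table_mul_e ?mu_tableE ?ltn_ord //; try lia.
  rewrite ifN ?(negPf Nyy) ?andbF ?orbF; last by lia.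
  have -> : (n == 1)%N = false by lia.
  by rewrite /= andbF scale0r scaler0.
split=> // _ v v0.
have n0 : (0 < n)%N by lia.
(* The ordinal [i] stands for e_(i+1), so these are the coordinates on e_1, ..., e_(n-2). Each
   reappears in v e_1 one index higher. *)
have v_low (i : 'I_n) : (i.+2 < n)%N -> v 0 i = 0.
  move=> lt_in; have := v0 (e 1); rewrite /= table_mulr //.
  move/rowP/(_ (Ordinal (ltnW lt_in))); rewrite mxE summxE (bigD1 i) //= big1.
    rewrite addr0 mxE mu_tableE ?ltn_ord // ifT; last by lia.
    by rewrite e_coord addn1 eqxx mulr1.
  move=> k ne_ki; rewrite mxE mu_tableE ?ltn_ord //.
  have -> : (1 == n)%N = false by lia.
  case: ifP => _; last by rewrite scale0r mxE mulr0.
  by rewrite e_coord addn1 !eqSS eq_sym (negPf (ne_ki : (k : nat) != i)) mulr0.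
(* The e_(n-1) component of v e_n is the e_n coordinate of v: a contribution from e_1 e_n is
   excluded by [v_low], since 1 < n-1. *)
have v_top (i : 'I_n) : i.+1 = n -> v 0 i = 0.
  move=> Di; have := v0 (e n); rewrite /= table_mulr ?n0 ?leqnn //.
  move/rowP/(_ (Ordinal lt_n2)); rewrite mxE summxE (bigD1 i) //= big1.
    rewrite addr0 mxE mu_tableE ?ltn_ord ?n0 ?leqnn // ifN; last by lia.
    rewrite Di !eqxx H orbT scale1r e_coord /=.
    by rewrite (_ : _ == _) ?mulr1 //; lia.
  move=> k ne_ki; rewrite mxE; have [lt_kn|ge_kn] := ltnP k.+2 n.
    by rewrite v_low ?mul0r.
  have {}ne_ki : (k : nat) != i by [].
  rewrite mu_tableE ?ltn_ord ?n0 ?leqnn // ifN; last by lia.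
  have [-> ->] : (k.+1 == n)%N = false /\ (k.+1 == 1)%N = false by lia.
  by rewrite andbF scale0r mxE mulr0.
exists (v 0 (Ordinal lt_n2) *: e 1), (e (n - 2)).
rewrite linearZl_LR /= table_mul_e ?mu_tableE ?n0 ?leqnn //; try lia.
rewrite ifT; last by lia.
have -> : (1 + (n - 2) = (n - 2).+1)%N by lia.
rewrite [LHS](row_sum_e v) (bigD1 (Ordinal lt_n2)) //= big1 ?addr0 // => i ne_i.
have {}ne_i : (i : nat) != (n - 2)%N by [].
have lti := ltn_ord i; have [lt_in|le_ni] := ltnP i.+2 n; first by rewrite v_low ?scale0r.
by rewrite v_top ?scale0r //; lia.
Qed.

End Invariants.

Theorem theorem3p6 (R : realType) (n : nat) (hn : (3 < n)%N) :
  (forall c : mu_label,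
     [/\ alg_assoc (mu R[i] n c), alg_dim (mu R[i] n c) = n
       & filiform (mu R[i] n c)]) /\
  (forall A : algebra R[i],
     alg_assoc A -> alg_dim A = n -> filiform A ->
     exists c : mu_label, alg_iso A (mu R[i] n c)) /\
  (forall c d : mu_label, c <> d -> ~ alg_iso (mu R[i] n c) (mu R[i] n d)).
Proof.
split=> [c|]; first by split; [exact: mu_assoc|exact: alg_dim_table|exact: mu_filiform].
split=> [A|c d ncd iso_cd]; first exact: filiform_classification.
(* The two invariants recover [mu_xy] and [mu_yy], and these two bits determine the label. *)
have := iso_commutative iso_cd; rewrite !mu_commutative //.
have := iso_annihilators_are_products iso_cd; rewrite !mu_annihilators_are_products //.
by case: c d ncd {iso_cd} => -[] //= _ [? ?] [? ?]; firstorder.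
Qed.
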